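(* Let $p\in\mathbb N$ and let $c=(c_T)_{T\in\mathcal J,\,T\ne\emptyset}\in\mathbb R_+^{2^p-1}$ be a vector of positive parameters indexed by the non-empty subsets of $\{1,\dots,p\}$. Suppose that the random vector $Y=(Y_1,\dots,Y_p)$ has probability mass function $$P(Y_1=l_1,\dots,Y_p=l_p)=\sum\ \prod_{T\in\mathcal J,\,T\neq\emptyset}\frac{e^{-c_T}c_T^{\,j_T}}{j_T!},\qquad l_1,\dots,l_p\in\mathbb N_0,$$ where the sum is over all families $(j_T)_{T\in\mathcal J,\,T\ne\emptyset}$ of non-negative integers such that $j_{k\bullet}=l_k$ for each $k=1,\dots,p$, with $$j_{k\bullet}=\sum_{T\in\mathcal J:\,k\in T}j_T .$$ Then the Laplace transform of $Y$ exists in a neighborhood of the origin and is of the form $$E\Big[\exp\Big(-\sum_{j=1}^p\eta_jY_j\Big)\Big]=\exp\Big(\sum_{T\in\mathcal J,\,T\neq\emptyset}c_T\big(e^{(-\eta)_T}-1\big)\Big)$$ for all sufficiently small $\eta_j>0$, $j=1,\dots,p$.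
   Context: $\mathcal J$ is the collection of all subsets of $\{1,\dots,p\}$. For $s\in\mathbb R^p$ and $T\in\mathcal J$, $s_T:=\sum_{j\in T}s_j$, so that $(-\eta)_T=-\sum_{j\in T}\eta_j$. $\mathbb N_0=\{0,1,2,\dots\}$. *)

(* Defs.v *)
From HB Require Import structures.
From mathcomp Require Import all_boot all_order all_algebra.
From mathcomp Require Import all_classical all_reals all_analysis.

Set Implicit Arguments.
Unset Strict Implicit.
Unset Printing Implicit Defensive.

Import Order.TTheory GRing.Theory Num.Theory.
Import numFieldNormedType.Exports.

Local Open Scope classical_set_scope.
Local Open Scope ring_scope.

(* {1, ..., p} is rendered as 'I_p. A notation, so that the finType structure
   of the sigma type is found. *)
Notation nonempty_subset p := {T : {set 'I_p} | T != finset.set0}.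

Section MultivariatePoisson.
Context {R : realType} {p : nat}.

(* s_T *)
Definition subset_sum (s : 'I_p -> R) (T : {set 'I_p}) : R :=
  \sum_(j in T) s j.

(* j_{k.} *)
Definition marginal (j : {ffun nonempty_subset p -> nat}) (k : 'I_p) : nat :=
  (\sum_(T : nonempty_subset p | k \in val T) j T)%N.

Definition families (l : 'I_p -> nat) : set {ffun nonempty_subset p -> nat} :=
  [set j | forall k, marginal j k = l k].

(* [families l] is finite, so this sum of nonnegative terms is a finite one;
   [esum] avoids having to prove that finiteness in the definition. *)
Definition mpoisson_pmf (c : nonempty_subset p -> R) (l : 'I_p -> nat) : \bar R :=
  \esum_(j in families l)
    (\prod_(T : nonempty_subset p)
      (expR (- c T) * c T ^+ j T / (j T)`!%:R))%:E.

End MultivariatePoisson.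

Section LaplaceTransform.
Context {d : measure_display} {Omega : measurableType d} {R : realType}.
Context {p : nat} (P : probability Omega R) (Y : 'I_p -> {RV P >-> R}).

Definition laplace_integrand (eta : 'I_p -> R) : Omega -> R :=
  fun w => expR (- \sum_(j < p) eta j * Y j w).

Definition laplace_exists (eta : 'I_p -> R) : Prop :=
  P.-integrable [set: Omega] (EFin \o laplace_integrand eta).

Definition laplace (eta : 'I_p -> R) : \bar R := 'E_P[laplace_integrand eta].

End LaplaceTransform.

(* Main.v *)
Require Import Defs.
From HB Require Import structures.
From mathcomp Require Import all_boot all_order all_algebra.
From mathcomp Require Import all_classical all_reals all_analysis.
From mathcomp Require Import measurable_realfun.

Import Order.TTheory GRing.Theory Num.Theory.
Import numFieldNormedType.Exports.

Local Open Scope classical_set_scope.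
Local Open Scope ring_scope.

(** Expand the definition of the probability mass function: it is the law of
    the vector of marginals [Y_k = \sum_(T | k \in T) J_T], where the [J_T] are
    independent Poisson variables with parameters [c T].  Since
    [\sum_k eta_k * Y_k = - \sum_T (-eta)_T * J_T], the Laplace transform of
    [Y] factors into the product over [T] of the Poisson transforms
    [exp (c_T * (exp (-eta)_T - 1))].

    The proof carries out this computation on nonnegative sums, without
    constructing the [J_T] on any probability space.  The expectation over the
    event that [Y] has values in [nat^p] is a sum over the value [l] of [Y]
    ([ge0_integral_bigcup_countType]); inserting the mass function turns it
    into a double sum over [l] and over the families [j] with marginals [l],
    that is, into a single sum over all families ([esum_fibers]).  The factor
    [exp (- \sum_k eta_k * l_k)] is absorbed into the Poisson weight of [j] by
    changing each parameter [c T] into [c T * exp (-eta)_T]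
    ([exp_marginal_weight]), and the sum over all families of a product of
    one-variable weights is the product of the one-variable series
    ([esum_prod_ffun]), which are exponential series.

    The variables [Y k] are only known to be real-valued, so it remains to see
    that [Y] has values in [nat^p] almost surely.  This is the same computation
    at [eta = 0], where it says that the masses sum to [1].  All of this holds
    for every real [eta], so any radius will do for the neighborhood. *)

(** * Sums of nonnegative families *)

Lemma esumZl (R : realType) (T : choiceType) (S : set T) (r : R)
    (a : T -> \bar R) : 0 < r -> (forall x, (0 <= a x)%E) ->
  (r%:E * (\esum_(x in S) a x) = \esum_(x in S) (r%:E * a x))%E.
Proof.
move=> r0 a0; rewrite /esum -ereal_sup_pZl//; congr ereal_sup.
rewrite image_comp; apply: eq_imagel => F _ /=.
by rewrite ge0_mule_fsumr.
Qed.

(** Summing fiber by fiber is a reindexing of a dependent double sum along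
    [j |-> (m j, j)]. *)
Lemma esum_fibers (R : realType) (J L : choiceType) (m : J -> L)
    (g : J -> \bar R) : (forall j, (0 <= g j)%E) ->
  \esum_(l in [set: L]) (\esum_(j in [set j | m j = l]) g j) =
  \esum_(j in [set: J]) g j.
Proof.
move=> g0; rewrite esum_esum//.
rewrite (reindex_esum [set: J] _ (fun j => (m j, j)))//.
by split=> [j _|j1 j2 _ _ [_ ->]|[l j] /= [_ <-]]//; exists j.
Qed.

Lemma cvg_bigprod (R : realType) (I : Type) (r : seq I) (u : I -> nat -> R)
    (l : I -> R) : (forall i, u i n @[n --> \oo] --> l i) ->
  \prod_(i <- r) u i n @[n --> \oo] --> \prod_(i <- r) l i.
Proof.
move=> ul; elim: r => [|i r IH].
  rewrite big_nil; under eq_fun do rewrite big_nil; exact: cvg_cst.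
by rewrite big_cons; under eq_fun do rewrite big_cons; exact: cvgM.
Qed.

(** * Sums over families of natural numbers *)

(** The range of this map is the box of the families with entries below [N]. *)
Definition box_embedding {I : finType} (N : nat) (f : {ffun I -> 'I_N}) :
  {ffun I -> nat} := [ffun i => val (f i)].

Lemma box_embedding_inj (I : finType) N : injective (@box_embedding I N).
Proof.
move=> f g /ffunP fg; apply/ffunP => i; apply: val_inj.
by have := fg i; rewrite !ffunE.
Qed.

(** On a box the claim of [esum_prod_ffun] is the distributivity of a finite
    product over finite sums. *)
Lemma esum_box (R : realType) (I : finType) (a : I -> nat -> R) (N : nat) :
  (forall i n, 0 <= a i n) ->
  \esum_(j in range (@box_embedding I N)) (\prod_i a i (j i))%:E =
  (\prod_i series (a i) N)%:E.
Proof.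
move=> a0; have p0 (j : {ffun I -> nat}) : (0 <= (\prod_i a i (j i))%:E)%E.
  by rewrite lee_fin prodr_ge0.
rewrite esum_image; last by move=> f g _ _; exact: box_embedding_inj.
rewrite esum_fset//; last exact: finite_finset.
have -> : [set: {ffun I -> 'I_N}] = [set` enum {ffun I -> 'I_N}].
  by apply/seteqP; split=> f _ //=; rewrite mem_enum.
rewrite -fsbig_seq ?enum_uniq// big_enum/= sumEFin.
congr EFin; under [RHS]eq_bigr do rewrite /series/= big_mkord.
rewrite bigA_distr_bigA; apply: eq_bigr => f _.
by apply: eq_bigr => i _; rewrite ffunE.
Qed.

(** A product of finitely many convergent series with nonnegative terms is the
    sum over all families of indices: every finite set of families lies in a
    box, whose sum is a product of partial sums and so at most the product of
    the limits, and these products of partial sums tend to that product. *)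
Lemma esum_prod_ffun (R : realType) (I : finType) (a : I -> nat -> R)
    (S : I -> R) :
  (forall i n, 0 <= a i n) -> (forall i, series (a i) @ \oo --> S i) ->
  \esum_(j in [set: {ffun I -> nat}]) (\prod_i a i (j i))%:E =
  (\prod_i S i)%:E.
Proof.
move=> a0 aS; have p0 (j : {ffun I -> nat}) : (0 <= (\prod_i a i (j i))%:E)%E.
  by rewrite lee_fin prodr_ge0.
have mono i : nondecreasing_seq (series (a i)).
  by apply: nondecreasing_series => n _ _; exact: a0.
have leS i N : series (a i) N <= S i.
  rewrite -(cvg_lim _ (aS i))//; apply: nondecreasing_cvgn_le => //.
  by apply/cvg_ex; exists (S i).
apply/eqP; rewrite eq_le; apply/andP; split.
- apply: ge_ereal_sup => _ [X [finX _] <-].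
  (* The strict bound makes every entry of a family in [X] an element of
     ['I_N]. *)
  pose N := (\max_(j <- finmap.enum_fset (fset_set X)) \max_i j i).+1.
  apply: (@le_trans _ _ (\prod_i series (a i) N)%:E).
    rewrite -esum_box//; apply: ereal_sup_ubound.
    exists X => //; split => // j Xj.
    have jN i : (j i < N)%N.
      rewrite ltnS (leq_trans (leq_bigmax i))//.
      apply: (@leq_bigmax_seq _ _ xpredT
        (fun j : {ffun I -> nat} => \max_i j i)%N) => //.
      by rewrite in_fset_set// inE.
    exists [ffun i => Ordinal (jN i)] => //.
    by apply/ffunP => i; rewrite !ffunE.
  rewrite lee_fin; apply: ler_prod => i _; rewrite leS andbT.
  by apply: sumr_ge0.
- have boxS : (\prod_i series (a i) N)%:E @[N --> \oo] --> (\prod_i S i)%:E.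
    by apply: cvg_EFin; [exact: nearW|exact: cvg_bigprod].
  rewrite -(cvg_lim _ boxS)//; apply: lime_le.
    by apply/cvg_ex; exists (\prod_i S i)%:E.
  apply: nearW => N; rewrite -esum_box// [leLHS]esum_mkcond.
  by apply: le_esum => j _; case: ifP.
Qed.

(** * Integration over a countable partition *)

(** The sets are laid out along [nat] by [pickle_inv], with [set0] at the
    integers that are not codes, so that countable additivity of the integral
    over sequences of sets applies. *)
Lemma ge0_integral_bigcup_countType (d : measure_display)
    (T : measurableType d) (R : realType) (mu : {measure set T -> \bar R})
    (L : countType) (A : L -> set T) (f : T -> \bar R) :
  (forall l, measurable (A l)) -> trivIset setT A ->
  measurable_fun setT f -> (forall x, (0 <= f x)%E) ->
  (\int[mu]_(x in \bigcup_l A l) f x =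
   \esum_(l in [set: L]) \int[mu]_(x in A l) f x)%E.
Proof.
move=> mA tA mf f0.
pose F n := if @pickle_inv L n is Some l then A l else set0.
have F_pickle l : F (pickle l) = A l by rewrite /F pickleK_inv.
have mF n : measurable (F n) by rewrite /F; case: pickle_inv.
have tF : trivIset setT F.
  move=> m n _ _; rewrite /F.
  have := @pickle_invK L m; have := @pickle_invK L n.
  case: pickle_inv => [l|]; case: pickle_inv => [l'|] /=.
  all: rewrite ?(set0I, setI0); try by move=> _ _ [].
  by move=> <- <- /tA ->.
have -> : \bigcup_l A l = \bigcup_n F n.
  apply/seteqP; split => [x [l _ Alx]|x [n _]].
    by exists (pickle l) => //; rewrite F_pickle.
  by rewrite /F; case: pickle_inv => [l|]// Alx; exists l.
rewrite ge0_integral_bigcup//; last exact: measurable_funTS.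
rewrite nneseries_esumT; last by move=> n; exact: integral_ge0.
under [RHS]eq_esum do rewrite -F_pickle.
rewrite -(esum_image setT (@pickle L) (fun n => \int[mu]_(x in F n) f x)%E);
  last first.
  by move=> l l' _ _; exact: (pcan_inj pickleK).
rewrite [RHS]esum_mkcond; apply: eq_esum => n _; case: ifPn => //.
rewrite notin_setE => nr; rewrite /F.
have := @pickle_invK L n.
case: pickle_inv => [l|] /=; last by rewrite integral_set0.
by move=> ln; case: nr; exists l.
Qed.

(** * Poisson weights *)

Section PoissonWeights.
Context {R : realType} {p : nat} (c : nonempty_subset p -> R).

(** Both sides collect, for each [T], a factor [exp (-eta)_T] per unit of
    [j T]: exchanging the sums over [k] and [T] rewrites the exponent as
    [\sum_T (-eta)_T * j T]. *)
Lemma exp_marginal_weight (eta : 'I_p -> R)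
    (j : {ffun nonempty_subset p -> nat}) :
  expR (- \sum_(k < p) eta k * (marginal j k)%:R) *
  (\prod_(T : nonempty_subset p) (expR (- c T) * c T ^+ j T / (j T)`!%:R)) =
  \prod_(T : nonempty_subset p) (expR (- c T) *
     exp_coeff (c T * expR (subset_sum (fun k => - eta k) (val T))) (j T)).
Proof.
have -> : - \sum_(k < p) eta k * (marginal j k)%:R =
    \sum_(T : nonempty_subset p)
      subset_sum (fun k => - eta k) (val T) * (j T)%:R.
  rewrite -sumrN /marginal.
  under eq_bigr do rewrite natr_sum -mulNr mulr_sumr.
  rewrite (exchange_big_dep predT)//=; apply: eq_bigr => T _.
  by rewrite /subset_sum mulr_suml.
rewrite expR_sum -big_split/=; apply: eq_bigr => T _.
rewrite /exp_coeff/= exprMn expRM_natr.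
by rewrite mulrC -!mulrA; congr (_ * (_ * _)); rewrite mulrC.
Qed.

Lemma poisson_transform_series (t s : R) :
  series (fun n => expR (- t) * exp_coeff (t * expR s) n) @ \oo -->
  expR (t * (expR s - 1)).
Proof.
have -> : series (fun n => expR (- t) * exp_coeff (t * expR s) n) =
    (fun N => expR (- t) * series (exp_coeff (t * expR s)) N).
  by apply/funext => N; rewrite /series/= mulr_sumr.
rewrite mulrBr mulr1 addrC expRD; apply: cvgMl_tmp.
exact: is_cvg_series_exp_coeff.
Qed.

End PoissonWeights.

(** * The events of prescribed integer values *)

Section Atoms.
Context {R : realType} {p : nat} {d : measure_display}.
Context {Omega : measurableType d} {P : probability Omega R}.
Context (Y : 'I_p -> {RV P >-> R}).

(** Indexing by finite functions makes the family of events countable. *)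
Definition atom (l : {ffun 'I_p -> nat}) : set Omega :=
  [set w | forall k, Y k w = (l k)%:R].

Lemma measurable_atom l : measurable (atom l).
Proof.
have -> : atom l = \bigcap_k (Y k @^-1` [set (l k)%:R]).
  by apply/seteqP; split=> w lw k => [_|]; exact: lw.
apply: fin_bigcap_measurable => [|k _]; first exact: finite_finset.
by rewrite -[X in measurable X]setTI; exact: measurable_funP.
Qed.

Lemma trivIset_atom : trivIset setT atom.
Proof.
move=> l l' _ _ [w [lw l'w]]; apply/ffunP => k; apply/eqP.
by rewrite -(@eqr_nat R) -lw -l'w.
Qed.

Lemma measurable_laplace_integrand (eta : 'I_p -> R) :
  measurable_fun setT (EFin \o laplace_integrand Y eta).
Proof.
apply/measurable_EFinP; apply: measurableT_comp => //.
apply: measurable_funN; apply: measurable_sum => k.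
exact: measurable_funM.
Qed.

Lemma measurable_bigcup_atom : measurable (\bigcup_l atom l).
Proof.
by apply: countable_bigcupT_measurable => //; exact: measurable_atom.
Qed.

End Atoms.

(** * The Laplace transform *)

Section Laplace.
Context {R : realType} {p : nat} {d : measure_display}.
Context {Omega : measurableType d} {P : probability Omega R}.
Context (Y : 'I_p -> {RV P >-> R}).
Context (c : nonempty_subset p -> R).
Context (c_gt0 : forall T, 0 < c T).
Context (pmfY : forall l : 'I_p -> nat,
  P [set w | forall k, Y k w = (l k)%:R] = mpoisson_pmf c l).

(** The mass function describes [Y] on this event only, where the integrand is
    constant on each atom.  The positive constant enters the sum over the
    families with marginals [l] and turns into the change of parameters of
    [exp_marginal_weight]; the sum over [l] then removes the constraint on the
    marginals. *)
Lemma integral_bigcup_atom (eta : 'I_p -> R) :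
  (\int[P]_(w in \bigcup_l atom Y l) (laplace_integrand Y eta w)%:E)%E =
  (expR (\sum_(T : nonempty_subset p)
      c T * (expR (subset_sum (fun k => - eta k) (val T)) - 1)))%:E.
Proof.
have w0 (j : {ffun nonempty_subset p -> nat}) :
    (0 <= (\prod_T (expR (- c T) * c T ^+ j T / (j T)`!%:R))%:E)%E.
  rewrite lee_fin prodr_ge0// => T _.
  by rewrite divr_ge0// mulr_ge0 ?expR_ge0// exprn_ge0// ltW.
rewrite ge0_integral_bigcup_countType; first last.
- by move=> w; rewrite lee_fin expR_ge0.
- exact: measurable_laplace_integrand.
- exact: trivIset_atom.
- exact: measurable_atom.
pose m (j : {ffun nonempty_subset p -> nat}) : {ffun 'I_p -> nat} :=
  [ffun k => marginal j k].
pose a (T : nonempty_subset p) n := expR (- c T) *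
  exp_coeff (c T * expR (subset_sum (fun k => - eta k) (val T))) n.
have a0 T n : 0 <= a T n.
  by rewrite mulr_ge0 ?expR_ge0// exp_coeff_ge0// mulr_ge0 ?expR_ge0 ?ltW.
transitivity (\esum_(l in [set: {ffun 'I_p -> nat}])
    \esum_(j in [set j | m j = l]) (\prod_T a T (j T))%:E).
  apply: eq_esum => l _.
  transitivity (\int[P]_(w in atom Y l)
      (cst (expR (- \sum_(k < p) eta k * (l k)%:R))%:E w))%E.
    apply: eq_integral => w; rewrite inE /atom/= => lw.
    by congr (expR (- _))%:E; apply: eq_bigr => k _; rewrite lw.
  rewrite integral_cst; last exact: measurable_atom.
  transitivity ((expR (- \sum_(k < p) eta k * (l k)%:R))%:E *
      mpoisson_pmf c l)%E.
    by congr (_ * _)%E; exact: pmfY.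
  rewrite /mpoisson_pmf esumZl ?expR_gt0//.
  have -> : families l = [set j | m j = l].
    apply/seteqP; split => j /=; last by move=> <- k; rewrite ffunE.
    by move=> jl; apply/ffunP => k; rewrite ffunE.
  apply: eq_esum => j /= <-; rewrite -EFinM; congr EFin.
  by rewrite -exp_marginal_weight; under eq_bigr do rewrite ffunE.
rewrite esum_fibers; last by move=> j; rewrite lee_fin prodr_ge0.
rewrite expR_sum; apply: esum_prod_ffun => // T.
exact: poisson_transform_series.
Qed.

(** The case [eta = 0] of the previous formula: the masses sum to [1]. *)
Lemma probability_bigcup_atom : P (\bigcup_l atom Y l) = 1%E.
Proof.
have := integral_bigcup_atom (fun=> 0).
rewrite [X in expR X]big1; last first.
  move=> T _; rewrite /subset_sum big1 ?expR0 ?subrr ?mulr0// => k _.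
  by rewrite oppr0.
rewrite expR0 => <-.
rewrite (eq_integral (cst 1%E)); last first.
  move=> w _; rewrite /laplace_integrand big1 ?oppr0 ?expR0// => k _.
  by rewrite mul0r.
by rewrite integral_cst ?mul1e//; exact: measurable_bigcup_atom.
Qed.

(** The complement of the union of the atoms is a null set. *)
Lemma integral_laplace_integrand (eta : 'I_p -> R) :
  (\int[P]_w (laplace_integrand Y eta w)%:E)%E =
  (expR (\sum_(T : nonempty_subset p)
      c T * (expR (subset_sum (fun k => - eta k) (val T)) - 1)))%:E.
Proof.
have mU := measurable_bigcup_atom Y; have mUC := measurableC mU.
have mf := measurable_laplace_integrand Y eta.
rewrite -integral_bigcup_atom -(setUv (\bigcup_l atom Y l)) ge0_integral_setU//.
- have PUC : P (~` \bigcup_l atom Y l) = 0%E.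
    by rewrite probability_setC// probability_bigcup_atom subee.
  rewrite [X in (_ + X)%E]null_set_integral ?adde0//.
  exact: measurable_funTS.
- exact: measurable_funTS.
- by move=> w _; rewrite lee_fin expR_ge0.
- by apply/disj_setPS => w [].
Qed.

End Laplace.

Theorem proposition6p2 (R : realType) (p : nat) (hp : (0 < p)%N)
    (c : nonempty_subset p -> R) (hc : forall T, 0 < c T)
    (d : measure_display) (Omega : measurableType d) (P : probability Omega R)
    (Y : 'I_p -> {RV P >-> R})
    (hY : forall l : 'I_p -> nat,
      P [set w | forall k, Y k w = (l k)%:R] = mpoisson_pmf c l) :
  exists2 delta : R, 0 < delta &
    (forall eta : 'I_p -> R, (forall j, `|eta j| < delta) ->
      laplace_exists Y eta) /\
    (forall eta : 'I_p -> R, (forall j, 0 < eta j < delta) ->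
      laplace Y eta =
        (expR (\sum_(T : nonempty_subset p)
          c T * (expR (subset_sum (fun j => - eta j) (val T)) - 1)))%:E).
Proof.
exists 1 => //; split => eta _.
- apply/integrableP; split; first exact: measurable_laplace_integrand.
  under eq_integral do rewrite /= ger0_norm ?expR_ge0//.
  by rewrite (integral_laplace_integrand Y c)// ltry.
- by rewrite /laplace unlock; exact: integral_laplace_integrand.
Qed.
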